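(* Let $X$ be a strictly convex normed linear space (real or complex), and let $x, y \in X \setminus \{0\}$ with $x \perp_B y$. Then $x \perp_{SB} y$.
   Context: $S_X = \{x \in X : \|x\| = 1\}$ and $B_X = \{x \in X : \|x\| \le 1\}$. $X$ is strictly convex iff every element of $S_X$ is an extreme point of $B_X$. For $x, y \in X$: $x \perp_B y$ (Birkhoff-James orthogonality) iff $\|x\| \le \|x + \lambda y\|$ for all scalars $\lambda$; $x \perp_{SB} y$ (strong Birkhoff-James orthogonality) iff $\|x\| < \|x + \lambda y\|$ for all scalars $\lambda \ne 0$. *)

(* Defs.v *)
From HB Require Import structures.
From mathcomp Require Import all_boot all_order all_algebra.
From mathcomp Require Import all_classical all_reals topology normedtype.
From mathcomp Require Import complex.

Set Implicit Arguments.
Unset Strict Implicit.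
Unset Printing Implicit Defensive.

Import Order.TTheory GRing.Theory Num.Theory.
Import numFieldNormedType.Exports.

Local Open Scope classical_set_scope.
Local Open Scope ring_scope.

(* The scalar field K is meant to be R or R[i] for a realType R.  Over R[i] the
   norm is R[i]-valued, and u <= v (resp. u < v) means that u and v have the
   same imaginary part and Re u <= Re v (resp. Re u < Re v).  In particular
   norms are nonnegative reals, and 0 < t < 1 forces t to be real. *)

Definition unit_sphere (K : numFieldType) (X : normedModType K) : set X :=
  [set x | `|x| = 1].
Arguments unit_sphere {K} X _.

Definition unit_ball (K : numFieldType) (X : normedModType K) : set X :=
  [set x | `|x| <= 1].
Arguments unit_ball {K} X _.

Definition extreme_point (K : numFieldType) (X : lmodType K)
    (A : set X) (x : X) : Prop :=
  A x /\
  forall (a b : X) (t : K), A a -> A b -> 0 < t -> t < 1 ->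
    x = t *: a + (1 - t) *: b -> a = x /\ b = x.

Definition strictly_convex (K : numFieldType) (X : normedModType K) : Prop :=
  forall x : X, unit_sphere X x -> extreme_point (unit_ball X) x.

Definition BJ_orthogonal (K : numFieldType) (X : normedModType K)
    (x y : X) : Prop :=
  forall l : K, `|x| <= `|x + l *: y|.

Definition strong_BJ_orthogonal (K : numFieldType) (X : normedModType K)
    (x y : X) : Prop :=
  forall l : K, l != 0 -> `|x| < `|x + l *: y|.

Arguments strictly_convex {K} X.

(* Main.v *)
(* If |x + l y| = |x| with l <> 0, then Birkhoff-James orthogonality forces the
   midpoint x + (l/2) y of x and x + l y to have norm at least |x|, hence exactly
   |x|; after scaling, it is a point of the unit sphere that is not extreme. *)
Require Import Defs.
From HB Require Import structures.
From mathcomp Require Import all_boot all_order all_algebra.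
From mathcomp Require Import all_classical all_reals topology normedtype complex.

Set Implicit Arguments.
Unset Strict Implicit.
Unset Printing Implicit Defensive.

Import Order.TTheory GRing.Theory Num.Theory.
Import numFieldNormedType.Exports.

Local Open Scope ring_scope.

(** Working over any [numFieldType] lets one argument serve both real and complex scalars. *)
Lemma strictly_convex_BJ_strong (K : numFieldType) (X : normedModType K)
    (x y : X) :
  strictly_convex X -> x != 0 -> y != 0 ->
  BJ_orthogonal x y -> strong_BJ_orthogonal x y.
Proof.
move=> scX x0 y0 xy l l0; rewrite lt_neqAle xy andbT.
apply/eqP => xE.
have r0 : 0 < `|x| by rewrite normr_gt0.
have scaled_norm (z : X) : `| `|x|^-1 *: z | = `|x|^-1 * `|z|.
  by rewrite normrZ gtr0_norm // invr_gt0.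
have half : 1 - 2^-1 = 2^-1 :> K by rewrite {1}[1]splitr mul1r addrK.
(* Dividing by the common norm of [x] and [x + l *: y] puts [u] and [v] on the unit sphere; [m] is
   their midpoint. *)
pose u := `|x|^-1 *: x.
pose v := `|x|^-1 *: (x + l *: y).
pose m := `|x|^-1 *: (x + (2^-1 * l) *: y).
have mE : m = 2^-1 *: u + (1 - 2^-1) *: v.
  rewrite half -scalerDr -scalerDr scalerA mulrC -scalerA; congr (_ *: _).
  by rewrite addrA scalerDr scalerA -mulr2n -(scaler_nat 2 x) scalerA mulVf
    ?pnatr_eq0 // scale1r.
have u1 : `|u| = 1 by rewrite scaled_norm mulVf // gt_eqF.
have v1 : `|v| = 1 by rewrite scaled_norm -xE mulVf // gt_eqF.
have m1 : `|m| = 1.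
  apply/eqP; rewrite eq_le; apply/andP; split.
    rewrite mE (le_trans (ler_normD _ _)) // (normrZ _ u) (normrZ _ v) half.
    rewrite u1 v1 !mulr1.
    by rewrite gtr0_norm ?invr_gt0 ?ltr0n // -[2^-1]mul1r -splitr.
  (* The lower bound is Birkhoff-James orthogonality at the scalar [2^-1 * l]. *)
  by rewrite scaled_norm mulrC ler_pdivlMr // mul1r.
have [_ ext] := scX m m1.
have [||||um vm] := ext u v 2^-1 _ _ _ _ mE.
- by rewrite /unit_ball /= u1.
- by rewrite /unit_ball /= v1.
- by rewrite invr_gt0 ltr0n.
- by rewrite invf_lt1 ?ltr0n // ltr1n.
(* Extremality of [m] gives [u = m = v]; cancelling the scaling leaves [l *: y = 0], which is
   impossible since [l] and [y] are nonzero. *)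
have /scalerI : `|x|^-1 *: x = `|x|^-1 *: (x + l *: y).
  by rewrite -/u -/v um vm.
rewrite invr_eq0 normr_eq0 => /(_ x0) /eqP.
by rewrite -subr_eq0 opprD addrA subrr add0r oppr_eq0 scaler_eq0
  (negPf l0) (negPf y0).
Qed.

Theorem theorem2p2 (R : realType) :
  (forall (X : normedModType R) (x y : X),
      strictly_convex X -> x != 0 -> y != 0 ->
      BJ_orthogonal x y -> strong_BJ_orthogonal x y) /\
  (forall (X : normedModType R[i]) (x y : X),
      strictly_convex X -> x != 0 -> y != 0 ->
      BJ_orthogonal x y -> strong_BJ_orthogonal x y).
Proof. by split=> X x y; exact: strictly_convex_BJ_strong. Qed.
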